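(* Let $\mathcal{K}$ be a category with finite products and finite coproducts (no other limits or colimits being assumed), equipped with a Quillen model structure whose class of weak equivalences is $\mathcal{W}$. Let $\mathcal{K}_{cf}$ be the full subcategory of $\mathcal{K}$ on the objects that are both cofibrant and fibrant, and let $\sim$ be the common restriction to $\mathcal{K}_{cf}$ of the left-homotopy relation $\stackrel{\ell}{\sim}$ and the right-homotopy relation $\stackrel{r}{\sim}$. Then $\sim$ is a congruence on the category $\mathcal{K}_{cf}$. Moreover, the quotient category $\mathcal{K}_{cf}/{\sim}$ is equivalent to the category of fractions $\mathcal{K}[\mathcal{W}^{-1}]$ obtained from $\mathcal{K}$ by inverting the weak equivalences.
   Context: Finite products and coproducts include the empty ones, so $\mathcal{K}$ has a terminal object $1$ and an initial object $0$. A Quillen model structure on $\mathcal{K}$ (in the sense of Hovey, Definition 1.1.3) consists of three subcategories of $\mathcal{K}$, called weak equivalences, cofibrations and fibrations (each closed under composition and containing all identities), together with two functorial factorizations, such that: (1) (two-out-of-three) if $f,g$ are composable and two of $f$, $g$, $gf$ are weak equivalences, then so is the third; (2) (retracts) if $f$ is a retract of $g$ in the arrow category and $g$ is a weak equivalence, cofibration or fibration, then so is $f$; (3) (lifting) call an arrow a trivial cofibration (resp. trivial fibration) if it is both a cofibration (resp. fibration) and a weak equivalence; then trivial cofibrations have the left lifting property with respect to fibrations, and cofibrations have the left lifting property with respect to trivial fibrations; (4) (factorization) the first functorial factorization writes every arrow as a cofibration followed by a trivial fibration, and the second writes every arrow as a trivial cofibration followed by a fibration. Here no limits or colimits beyond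 finite products and finite coproducts are assumed to exist in $\mathcal{K}$. An object $x$ is cofibrant if $0\to x$ is a cofibration, and fibrant if $x\to 1$ is a fibration. Let $\alpha,\beta: x\to y$ be parallel arrows in $\mathcal{K}$. Write $[\alpha,\beta]: x+x\to y$ and $(\alpha,\beta): x\to y\times y$ for the induced arrows, $\nabla=[\mathrm{id}_x,\mathrm{id}_x]: x+x\to x$ and $\Delta=(\mathrm{id}_y,\mathrm{id}_y): y\to y\times y$. - $\alpha$ and $\beta$ are left-homotopic, $\alpha\stackrel{\ell}{\sim}\beta$, if there exist an object $c$, a cofibration $\mu: x+x\to c$, a weak equivalence $\sigma: c\to x$ with $\sigma\mu=\nabla$, and an arrow $\omega: c\to y$ with $\omega\mu=[\alpha,\beta]$. - $\alpha$ and $\beta$ are right-homotopic, $\alpha\stackrel{r}{\sim}\beta$, if there exist an object $p$, a fibration $\varpi: p\to y\times y$, a weak equivalence $\kappa: y\to p$ with $\varpi\kappa=\Delta$, and an arrow $\psi: x\to p$ with $\varpi\psi=(\alpha,\beta)$. It is well known (using only finite products and coproducts) that for arrows between objects of $\mathcal{K}_{cf}$ the relations $\stackrel{\ell}{\sim}$ and $\stackrel{r}{\sim}$ coincide; $\sim$ denotes this common relation on arrows of $\mathcal{K}_{cf}$. A congruence on a category is a family of equivalence relations, one on each hom-set, compatible with composition on both sides; the quotient category has the same objects and has equivalence classes of arrows as arrows. $\mathcal{K}[\mathcal{W}^{-1}]$ is the localization of $\mathcal{K}$ universally inverting the arrows in $\mathcal{W}$. *)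

(* Defs.v *)
From Stdlib Require Import RelationClasses.
From Stdlib Require Import FunctionalExtensionality PropExtensionality.
From Stdlib Require Import ProofIrrelevance ClassicalEpsilon.

Set Implicit Arguments.
Unset Strict Implicit.
Unset Printing Implicit Defensive.
#[local] Obligation Tactic := idtac.

Record category := Category {
  ob :> Type;
  hom : ob -> ob -> Type;
  idc : forall x, hom x x;
  comp : forall x y z, hom y z -> hom x y -> hom x z;
  comp_idl : forall x y (f : hom x y), comp (idc y) f = f;
  comp_idr : forall x y (f : hom x y), comp f (idc x) = f;
  comp_assoc : forall x y z t (h : hom z t) (g : hom y z) (f : hom x y),
    comp h (comp g f) = comp (comp h g) f
}.
Arguments hom {c} x y.
Arguments idc {c} x.
Arguments comp {c x y z} g f.

Declare Scope cat_scope.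
Delimit Scope cat_scope with cat.
Notation "g ∘ f" := (comp g f) (at level 40, left associativity) : cat_scope.
Open Scope cat_scope.

Definition is_iso (K : category) (x y : K) (f : hom x y) : Prop :=
  exists g : hom y x, g ∘ f = idc x /\ f ∘ g = idc y.

Record functor (C D : category) := Functor {
  fob :> C -> D;
  fhom : forall x y, hom x y -> hom (fob x) (fob y);
  fhom_id : forall x, fhom (idc x) = idc (fob x);
  fhom_comp : forall x y z (g : hom y z) (f : hom x y),
    fhom (g ∘ f) = fhom g ∘ fhom f
}.
Arguments fhom {C D} f {x y} a : rename.

Definition id_functor (C : category) : functor C C :=
  @Functor C C (fun x => x) (fun _ _ f => f)
    (fun _ => eq_refl) (fun _ _ _ _ _ => eq_refl).

Program Definition comp_functor (C D E : category)
    (G : functor D E) (F : functor C D) : functor C E :=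
  @Functor C E (fun x => G (F x)) (fun _ _ f => fhom G (fhom F f)) _ _.
Next Obligation. intros; cbn; now rewrite !fhom_id. Qed.
Next Obligation. intros; cbn; now rewrite !fhom_comp. Qed.

Record nat_iso (C D : category) (F G : functor C D) := NatIso {
  nat_map : forall x : C, hom (F x) (G x);
  nat_naturality : forall (x y : C) (f : hom x y),
    nat_map y ∘ fhom F f = fhom G f ∘ nat_map x;
  nat_is_iso : forall x : C, is_iso (nat_map x)
}.

Definition equivalent_categories (C D : category) : Prop :=
  exists (F : functor C D) (G : functor D C),
    inhabited (nat_iso (comp_functor G F) (id_functor C)) /\
    inhabited (nat_iso (comp_functor F G) (id_functor D)).

Program Definition full_subcategory (K : category) (P : K -> Prop) : category :=
  @Category {x : K | P x} (fun x y => hom (proj1_sig x) (proj1_sig y))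
    (fun x => idc (proj1_sig x)) (fun _ _ _ g f => g ∘ f) _ _ _.
Next Obligation. intros; apply comp_idl. Qed.
Next Obligation. intros; apply comp_idr. Qed.
Next Obligation. intros; apply comp_assoc. Qed.

Record finite_products (K : category) := FiniteProducts {
  terminal : K;
  to_terminal : forall x : K, hom x terminal;
  to_terminal_unique : forall (x : K) (f : hom x terminal), f = to_terminal x;
  prod : K -> K -> K;
  pr1 : forall x y : K, hom (prod x y) x;
  pr2 : forall x y : K, hom (prod x y) y;
  pair : forall z x y : K, hom z x -> hom z y -> hom z (prod x y);
  pr1_pair : forall (z x y : K) (f : hom z x) (g : hom z y),
    pr1 x y ∘ pair f g = f;
  pr2_pair : forall (z x y : K) (f : hom z x) (g : hom z y),
    pr2 x y ∘ pair f g = g;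
  pair_unique : forall (z x y : K) (h : hom z (prod x y)),
    h = pair (pr1 x y ∘ h) (pr2 x y ∘ h)
}.
Arguments pair {K} f {z x y} _ _ : rename.

Record finite_coproducts (K : category) := FiniteCoproducts {
  initial : K;
  of_initial : forall x : K, hom initial x;
  of_initial_unique : forall (x : K) (f : hom initial x), f = of_initial x;
  coprod : K -> K -> K;
  in1 : forall x y : K, hom x (coprod x y);
  in2 : forall x y : K, hom y (coprod x y);
  copair : forall x y z : K, hom x z -> hom y z -> hom (coprod x y) z;
  copair_in1 : forall (x y z : K) (f : hom x z) (g : hom y z),
    copair f g ∘ in1 x y = f;
  copair_in2 : forall (x y z : K) (f : hom x z) (g : hom y z),
    copair f g ∘ in2 x y = g;
  copair_unique : forall (x y z : K) (h : hom (coprod x y) z),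
    h = copair (h ∘ in1 x y) (h ∘ in2 x y)
}.
Arguments copair {K} f {x y z} _ _ : rename.

Definition arrow_class (K : category) := forall x y : K, hom x y -> Prop.

Definition is_wide_subcategory (K : category) (A : arrow_class K) : Prop :=
  (forall x : K, A x x (idc x)) /\
  (forall (x y z : K) (g : hom y z) (f : hom x y),
     A y z g -> A x y f -> A x z (g ∘ f)).

Definition retract_of (K : category) (x y a b : K)
    (f : hom x y) (g : hom a b) : Prop :=
  exists (i : hom x a) (r : hom a x) (j : hom y b) (s : hom b y),
    r ∘ i = idc x /\ s ∘ j = idc y /\ g ∘ i = j ∘ f /\ f ∘ r = s ∘ g.

Definition retract_closed (K : category) (A : arrow_class K) : Prop :=
  forall (x y a b : K) (f : hom x y) (g : hom a b),
    retract_of f g -> A a b g -> A x y f.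

Definition has_llp (K : category) (x y a b : K)
    (f : hom x y) (g : hom a b) : Prop :=
  forall (u : hom x a) (v : hom y b), g ∘ u = v ∘ f ->
    exists h : hom y a, h ∘ f = u /\ g ∘ h = v.

Definition two_out_of_three (K : category) (W : arrow_class K) : Prop :=
  forall (x y z : K) (f : hom x y) (g : hom y z),
    (W x y f -> W y z g -> W x z (g ∘ f)) /\
    (W x y f -> W x z (g ∘ f) -> W y z g) /\
    (W y z g -> W x z (g ∘ f) -> W x y f).

(** A pair of endofunctors of the arrow category factoring every arrow
    [f] as [fact_right f ∘ fact_left f], given by components: the two
    endofunctors share the object part [fact_ob] and the middle arrow
    [fact_map] of the image of a commuting square [(u, v) : f -> f']. *)
Record functorial_factorization (K : category) := FunctorialFactorization {
  fact_ob : forall x y : K, hom x y -> K;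
  fact_left : forall (x y : K) (f : hom x y), hom x (fact_ob f);
  fact_right : forall (x y : K) (f : hom x y), hom (fact_ob f) y;
  fact_eq : forall (x y : K) (f : hom x y), fact_right f ∘ fact_left f = f;
  fact_map : forall (x y x' y' : K) (f : hom x y) (f' : hom x' y')
    (u : hom x x') (v : hom y y'),
    f' ∘ u = v ∘ f -> hom (fact_ob f) (fact_ob f');
  fact_map_left : forall (x y x' y' : K) (f : hom x y) (f' : hom x' y')
    (u : hom x x') (v : hom y y') (sq : f' ∘ u = v ∘ f),
    fact_left f' ∘ u = fact_map sq ∘ fact_left f;
  fact_map_right : forall (x y x' y' : K) (f : hom x y) (f' : hom x' y')
    (u : hom x x') (v : hom y y') (sq : f' ∘ u = v ∘ f),
    fact_right f' ∘ fact_map sq = v ∘ fact_right f;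
  fact_map_id : forall (x y : K) (f : hom x y) (sq : f ∘ idc x = idc y ∘ f),
    fact_map sq = idc (fact_ob f);
  fact_map_comp : forall (x y x' y' x'' y'' : K)
    (f : hom x y) (f' : hom x' y') (f'' : hom x'' y'')
    (u : hom x x') (v : hom y y') (u' : hom x' x'') (v' : hom y' y'')
    (sq : f' ∘ u = v ∘ f) (sq' : f'' ∘ u' = v' ∘ f')
    (sq'' : f'' ∘ (u' ∘ u) = (v' ∘ v) ∘ f),
    fact_map sq'' = fact_map sq' ∘ fact_map sq
}.

Record model_structure (K : category) := ModelStructure {
  weq : arrow_class K;
  cof : arrow_class K;
  fib : arrow_class K;
  fact_cof_tfib : functorial_factorization K;
  fact_tcof_fib : functorial_factorization K;
  weq_subcategory : is_wide_subcategory weq;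
  cof_subcategory : is_wide_subcategory cof;
  fib_subcategory : is_wide_subcategory fib;
  weq_two_out_of_three : two_out_of_three weq;
  weq_retract : retract_closed weq;
  cof_retract : retract_closed cof;
  fib_retract : retract_closed fib;
  tcof_fib_lift : forall (x y a b : K) (f : hom x y) (g : hom a b),
    cof f -> weq f -> fib g -> has_llp f g;
  cof_tfib_lift : forall (x y a b : K) (f : hom x y) (g : hom a b),
    cof f -> fib g -> weq g -> has_llp f g;
  fact_cof_tfib_spec : forall (x y : K) (f : hom x y),
    cof (fact_left fact_cof_tfib f) /\
    fib (fact_right fact_cof_tfib f) /\ weq (fact_right fact_cof_tfib f);
  fact_tcof_fib_spec : forall (x y : K) (f : hom x y),
    cof (fact_left fact_tcof_fib f) /\ weq (fact_left fact_tcof_fib f) /\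
    fib (fact_right fact_tcof_fib f)
}.
Arguments weq {K} m [x y] f : rename.
Arguments cof {K} m [x y] f : rename.
Arguments fib {K} m [x y] f : rename.

Definition cofibrant (K : category) (S : finite_coproducts K)
    (M : model_structure K) (x : K) : Prop :=
  cof M (of_initial S x).

Definition fibrant (K : category) (P : finite_products K)
    (M : model_structure K) (x : K) : Prop :=
  fib M (to_terminal P x).

Definition cf_subcategory (K : category) (P : finite_products K)
    (S : finite_coproducts K) (M : model_structure K) : category :=
  full_subcategory (fun x : K => cofibrant S M x /\ fibrant P M x).

Definition left_homotopic (K : category) (S : finite_coproducts K)
    (M : model_structure K) (x y : K) (alpha beta : hom x y) : Prop :=
  exists (c : K) (mu : hom (coprod S x x) c) (sigma : hom c x) (omega : hom c y),
    cof M mu /\ weq M sigma /\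
    sigma ∘ mu = copair S (idc x) (idc x) /\
    omega ∘ mu = copair S alpha beta.

Definition right_homotopic (K : category) (P : finite_products K)
    (M : model_structure K) (x y : K) (alpha beta : hom x y) : Prop :=
  exists (p : K) (varpi : hom p (prod P y y)) (kappa : hom y p) (psi : hom x p),
    fib M varpi /\ weq M kappa /\
    varpi ∘ kappa = pair P (idc y) (idc y) /\
    varpi ∘ psi = pair P alpha beta.

Definition hom_relation (C : category) :=
  forall x y : C, hom x y -> hom x y -> Prop.

Record is_congruence (C : category) (R : hom_relation C) : Prop := IsCongruence {
  cong_equiv : forall x y : C, Equivalence (R x y);
  cong_post : forall (x y z : C) (g : hom y z) (f f' : hom x y),
    R x y f f' -> R x z (g ∘ f) (g ∘ f');
  cong_pre : forall (x y z : C) (g g' : hom y z) (f : hom x y),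
    R y z g g' -> R x z (g ∘ f) (g' ∘ f)
}.

Definition quot (T : Type) (R : T -> T -> Prop) : Type :=
  {A : T -> Prop | exists a : T, A = R a}.

Definition qclass (T : Type) (R : T -> T -> Prop) (a : T) : quot R :=
  exist _ (R a) (ex_intro _ a eq_refl).

Definition qrepr (T : Type) (R : T -> T -> Prop) (q : quot R) : T :=
  proj1_sig (constructive_indefinite_description _ (proj2_sig q)).

Lemma qclass_qrepr (T : Type) (R : T -> T -> Prop) (q : quot R) :
  qclass R (qrepr q) = q.
Proof.
unfold qrepr; destruct (constructive_indefinite_description _ _) as [a Ha]; cbn.
destruct q as [A HA]; cbn in Ha; subst A.
unfold qclass; f_equal; apply proof_irrelevance.
Qed.

Lemma qclass_eq (T : Type) (R : T -> T -> Prop) (HR : Equivalence R) (a b : T) :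
  qclass R a = qclass R b <-> R a b.
Proof.
split; intros H.
- apply (f_equal (@proj1_sig _ _)) in H; cbn in H; rewrite H; reflexivity.
- assert (E : R a = R b).
  { apply functional_extensionality; intros c; apply propositional_extensionality.
    split; intros Hc; [transitivity a | transitivity b]; auto; now symmetry. }
  unfold qclass; apply eq_sig_hprop; cbn; auto.
  intros; apply proof_irrelevance.
Qed.

Lemma qrepr_qclass (T : Type) (R : T -> T -> Prop) (HR : Equivalence R) (a : T) :
  R (qrepr (qclass R a)) a.
Proof. apply (qclass_eq HR), qclass_qrepr. Qed.

Section Quotient.
Variables (C : category) (R : hom_relation C) (HR : is_congruence R).
Arguments R : clear implicits.

Definition qcomp (x y z : C) (q : quot (R y z)) (p : quot (R x y)) : quot (R x z) :=
  qclass (R x z) (qrepr q ∘ qrepr p).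

Lemma qcomp_qclass (x y z : C) (g : hom y z) (f : hom x y) :
  qcomp (qclass (R y z) g) (qclass (R x y) f) = qclass (R x z) (g ∘ f).
Proof.
pose proof (cong_equiv HR) as E.
apply (qclass_eq (E x z)).
transitivity (g ∘ qrepr (qclass (R x y) f)).
- apply (cong_pre HR), qrepr_qclass; auto.
- apply (cong_post HR), qrepr_qclass; auto.
Qed.

Program Definition quotient_category : category :=
  @Category C (fun x y => quot (R x y)) (fun x => qclass (R x x) (idc x)) qcomp _ _ _.
Next Obligation.
intros x y f; cbn; rewrite <- (qclass_qrepr f), qcomp_qclass; now rewrite comp_idl.
Qed.
Next Obligation.
intros x y f; cbn; rewrite <- (qclass_qrepr f), qcomp_qclass; now rewrite comp_idr.
Qed.
Next Obligation.
intros x y z t h g f; cbn.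
rewrite <- (qclass_qrepr h), <- (qclass_qrepr g), <- (qclass_qrepr f).
rewrite !qcomp_qclass; now rewrite comp_assoc.
Qed.

End Quotient.

(** The two homotopy relations agree on [cf_subcategory P S M], so
    choosing the left one here is immaterial. *)
Definition cf_homotopic (K : category) (P : finite_products K)
    (S : finite_coproducts K) (M : model_structure K) :
    hom_relation (cf_subcategory P S M) :=
  fun x y alpha beta =>
    @left_homotopic K S M (proj1_sig x) (proj1_sig y) alpha beta.
Arguments cf_homotopic {K} P S M [x y] alpha beta.

Definition inverts (K D : category) (W : arrow_class K) (F : functor K D) : Prop :=
  forall (x y : K) (f : hom x y), W x y f -> is_iso (fhom F f).

(** The universal property is the strict (Gabriel-Zisman) one: functors
    out of the localization are compared by equality. *)
Record localization (K : category) (W : arrow_class K) := Localization {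
  loc_category :> category;
  loc_functor : functor K loc_category;
  loc_inverts : inverts W loc_functor;
  loc_universal : forall (D : category) (F : functor K D), inverts W F ->
    exists! G : functor loc_category D, comp_functor G loc_functor = F
}.

Section Fractions.
Variables (K : category) (W : arrow_class K).
Arguments W : clear implicits.

Inductive word : K -> K -> Type :=
| word_arr (x y : K) (f : hom x y) : word x y
| word_inv (x y : K) (f : hom x y) (Wf : W x y f) : word y x
| word_comp (x y z : K) (v : word y z) (u : word x y) : word x z.

Inductive word_eq : forall x y : K, word x y -> word x y -> Prop :=
| word_eq_refl x y (u : word x y) : word_eq u u
| word_eq_sym x y (u v : word x y) : word_eq u v -> word_eq v u
| word_eq_trans x y (u v w : word x y) : word_eq u v -> word_eq v w -> word_eq u w
| word_eq_comp x y z (v v' : word y z) (u u' : word x y) :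
    word_eq v v' -> word_eq u u' -> word_eq (word_comp v u) (word_comp v' u')
| word_eq_assoc x y z t (w : word z t) (v : word y z) (u : word x y) :
    word_eq (word_comp w (word_comp v u)) (word_comp (word_comp w v) u)
| word_eq_idl x y (u : word x y) : word_eq (word_comp (word_arr (idc y)) u) u
| word_eq_idr x y (u : word x y) : word_eq (word_comp u (word_arr (idc x))) u
| word_eq_arr x y z (g : hom y z) (f : hom x y) :
    word_eq (word_comp (word_arr g) (word_arr f)) (word_arr (g ∘ f))
| word_eq_invl x y (f : hom x y) (Wf : W x y f) :
    word_eq (word_comp (word_inv Wf) (word_arr f)) (word_arr (idc x))
| word_eq_invr x y (f : hom x y) (Wf : W x y f) :
    word_eq (word_comp (word_arr f) (word_inv Wf)) (word_arr (idc y)).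

Lemma word_eq_equiv (x y : K) : Equivalence (@word_eq x y).
Proof.
split; [exact (@word_eq_refl x y) | exact (@word_eq_sym x y) | exact (@word_eq_trans x y)].
Qed.

Definition wclass (x y : K) (u : word x y) : quot (@word_eq x y) :=
  qclass (@word_eq x y) u.

Definition wcomp (x y z : K) (q : quot (@word_eq y z)) (p : quot (@word_eq x y)) :
    quot (@word_eq x z) :=
  wclass (word_comp (qrepr q) (qrepr p)).

Lemma wcomp_wclass (x y z : K) (v : word y z) (u : word x y) :
  wcomp (wclass v) (wclass u) = wclass (word_comp v u).
Proof.
apply (qclass_eq (word_eq_equiv x z)).
apply word_eq_comp; apply qrepr_qclass, word_eq_equiv.
Qed.

Lemma wclass_eq (x y : K) (u v : word x y) : word_eq u v -> wclass u = wclass v.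
Proof. apply (qclass_eq (word_eq_equiv x y)). Qed.

Program Definition fractions_category : category :=
  @Category K (fun x y => quot (@word_eq x y)) (fun x => wclass (word_arr (idc x)))
    wcomp _ _ _.
Next Obligation.
intros x y f; cbn; rewrite <- (qclass_qrepr f); fold (wclass (qrepr f)).
rewrite wcomp_wclass; apply wclass_eq, word_eq_idl.
Qed.
Next Obligation.
intros x y f; cbn; rewrite <- (qclass_qrepr f); fold (wclass (qrepr f)).
rewrite wcomp_wclass; apply wclass_eq, word_eq_idr.
Qed.
Next Obligation.
intros x y z t h g f; cbn.
rewrite <- (qclass_qrepr h), <- (qclass_qrepr g), <- (qclass_qrepr f).
fold (wclass (qrepr f)) (wclass (qrepr g)) (wclass (qrepr h)).
rewrite !wcomp_wclass; apply wclass_eq, word_eq_assoc.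
Qed.

Program Definition fractions_functor : functor K fractions_category :=
  @Functor K fractions_category (fun x => x) (fun _ _ f => wclass (word_arr f)) _ _.
Next Obligation. reflexivity. Qed.
Next Obligation.
intros; cbn; rewrite wcomp_wclass; symmetry; apply wclass_eq, word_eq_arr.
Qed.

Lemma fractions_inverts : inverts W fractions_functor.
Proof.
intros x y f Wf; exists (wclass (word_inv Wf)); cbn.
split; rewrite wcomp_wclass; apply wclass_eq;
  first [apply word_eq_invl | apply word_eq_invr].
Qed.

Section Lift.
Variables (D : category) (F : functor K D) (FW : inverts W F).

Fixpoint word_eval (x y : K) (u : word x y) : hom (F x) (F y) :=
  match u in word x y return hom (F x) (F y) with
  | word_arr f => fhom F f
  | word_inv Wf => proj1_sig (constructive_indefinite_description _ (FW Wf))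
  | word_comp v u => word_eval v ∘ word_eval u
  end.

Lemma word_eval_eq (x y : K) (u v : word x y) :
  word_eq u v -> word_eval u = word_eval v.
Proof.
induction 1; cbn; auto.
- congruence.
- congruence.
- apply comp_assoc.
- now rewrite fhom_id, comp_idl.
- now rewrite fhom_id, comp_idr.
- now rewrite fhom_comp.
- destruct (constructive_indefinite_description _ _) as [g [Hl Hr]]; cbn.
  now rewrite fhom_id.
- destruct (constructive_indefinite_description _ _) as [g [Hl Hr]]; cbn.
  now rewrite fhom_id.
Qed.

Lemma word_eval_repr (x y : K) (u : word x y) :
  word_eval (qrepr (wclass u)) = word_eval u.
Proof. apply word_eval_eq, qrepr_qclass, word_eq_equiv. Qed.

Program Definition fractions_lift : functor fractions_category D :=
  @Functor fractions_category D (fun x => F x) (fun _ _ q => word_eval (qrepr q)) _ _.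
Next Obligation. intros; cbn; rewrite word_eval_repr; apply fhom_id. Qed.
Next Obligation. intros; cbn; unfold wcomp; now rewrite word_eval_repr. Qed.

End Lift.

Lemma functor_eq_hom (C D : category) (o : C -> D)
    (h h' : forall x y, hom x y -> hom (o x) (o y)) i c i' c' :
  (forall x y (f : hom x y), h x y f = h' x y f) ->
  @Functor C D o h i c = @Functor C D o h' i' c'.
Proof.
intros E; assert (h = h') as E'.
{ extensionality x; extensionality y; extensionality f; apply E. }
subst h'; f_equal; apply proof_irrelevance.
Qed.

Lemma fractions_lift_comp (D : category) (F : functor K D) (FW : inverts W F) :
  comp_functor (fractions_lift FW) fractions_functor = F.
Proof.
destruct F as [o h i c]; unfold comp_functor; cbn.
apply functor_eq_hom; intros x y f.
exact (word_eval_repr FW (word_arr f)).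
Qed.

Lemma fractions_lift_unique (D : category) (G : functor fractions_category D)
    (GW : inverts W (comp_functor G fractions_functor)) :
  fractions_lift GW = G.
Proof.
assert (E : forall x y (u : word x y), word_eval GW u = fhom G (wclass u)).
{ intros x y u; induction u as [x y f | x y f Wf | x y z v IHv u IHu]; cbn.
  - reflexivity.
  - destruct (constructive_indefinite_description _ _) as [g [Hl Hr]]; cbn in *.
    assert (Hi : fhom G (wclass (word_arr f)) ∘ fhom G (wclass (word_inv Wf))
                 = idc _).
    { rewrite <- fhom_comp; cbn; rewrite wcomp_wclass.
      rewrite (wclass_eq (word_eq_invr Wf)); apply (fhom_id G). }
    rewrite <- (comp_idr g), <- Hi, comp_assoc, Hl; apply comp_idl.
  - rewrite IHv, IHu, <- fhom_comp; cbn; now rewrite wcomp_wclass. }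
destruct G as [o h i c]; unfold fractions_lift; cbn.
apply functor_eq_hom; intros x y q; rewrite E; cbn.
unfold wclass; now rewrite qclass_qrepr.
Qed.

Lemma fractions_universal (D : category) (F : functor K D) : inverts W F ->
  exists! G : functor fractions_category D, comp_functor G fractions_functor = F.
Proof.
intros FW; exists (fractions_lift FW); split.
- apply fractions_lift_comp.
- intros G HG; subst F; apply fractions_lift_unique.
Qed.

Definition fractions : localization W :=
  Localization fractions_inverts fractions_universal.

End Fractions.

(* Main.v *)
(** Left and right homotopies can be composed with each other, without any
    pushout or pullback: if [x] is cofibrant, an end of a cylinder [c] on [x] is
    a trivial cofibration, so a path-object homotopy given at one end of [c]
    lifts along the path fibration to all of [c], and its value at the other end
    is the composite.  This (with its dual) gives the agreement of the two
    relations and the congruence.  A weak equivalence of cofibrant-fibrant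
    objects factors as a trivial cofibration and a trivial fibration, each of
    which has a one-sided inverse that a lifting turns into a homotopy inverse.
    Hence the functorial cofibrant-fibrant replacement, followed by the quotient,
    inverts weak equivalences and factors through the localization, while the
    localization identifies homotopic arrows.  The two induced functors are
    mutually inverse up to the isomorphisms given by the replacement zigzag
    [x <- Qx -> RQx]. *)
From Stdlib Require Import RelationClasses ProofIrrelevance ClassicalEpsilon.
Require Import Defs.

Set Implicit Arguments.
Unset Strict Implicit.
Unset Printing Implicit Defensive.
#[local] Obligation Tactic := idtac.

(** * Isomorphisms, functors and natural isomorphisms *)

Lemma is_iso_comp (C : category) (x y z : C) (g : hom y z) (f : hom x y) :
  is_iso g -> is_iso f -> is_iso (g ∘ f).
Proof.
intros [g' [Hg1 Hg2]] [f' [Hf1 Hf2]]; exists (f' ∘ g'); split.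
- now rewrite comp_assoc, <- (comp_assoc f'), Hg1, comp_idr.
- now rewrite comp_assoc, <- (comp_assoc g), Hf2, comp_idr.
Qed.

Lemma is_iso_fhom (C D : category) (F : functor C D) (x y : C) (f : hom x y) :
  is_iso f -> is_iso (fhom F f).
Proof.
intros [g [H1 H2]]; exists (fhom F g).
now rewrite <- !fhom_comp, H1, H2, !fhom_id.
Qed.

Lemma is_iso_mono (C : category) (x y z : C) (s : hom y z) (f g : hom x y) :
  is_iso s -> s ∘ f = s ∘ g -> f = g.
Proof.
intros [t [Hl _]] H.
now rewrite <- (comp_idl f), <- (comp_idl g), <- Hl, <- !comp_assoc, H.
Qed.

Lemma nat_iso_sym (C D : category) (F G : functor C D) :
  inhabited (nat_iso F G) -> inhabited (nat_iso G F).
Proof.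
intros [[m nat iso]].
pose (inv := fun x => constructive_indefinite_description _ (iso x)).
constructor; refine (@NatIso C D G F (fun x => proj1_sig (inv x)) _ _).
- intros x y f; destruct (inv x) as [a [Ha1 Ha2]], (inv y) as [b [Hb1 Hb2]]; cbn.
  rewrite <- (comp_idr (b ∘ _)), <- Ha2, comp_assoc, <- (comp_assoc b), <- nat.
  now rewrite comp_assoc, Hb1, comp_idl.
- intros x; destruct (inv x) as [a [Ha1 Ha2]]; exists (m x); auto.
Qed.

Lemma nat_iso_trans (C D : category) (F G H : functor C D) :
  inhabited (nat_iso F G) -> inhabited (nat_iso G H) -> inhabited (nat_iso F H).
Proof.
intros [[m mn mi]] [[n nn ni]].
constructor; refine (@NatIso C D F H (fun x => n x ∘ m x) _ _).
- intros x y f.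
  now rewrite <- comp_assoc, mn, comp_assoc, nn, comp_assoc.
- intros x; apply is_iso_comp; auto.
Qed.

(** Invertibility is asked only after [H]: the replacement maps are weak equivalences, which become
    isomorphisms only in the target of [H]. *)
Lemma nat_iso_whisker (C D E : category) (H : functor D E) (F G : functor C D)
    (m : forall x : C, hom (F x) (G x)) :
  (forall (x y : C) (f : hom x y), m y ∘ fhom F f = fhom G f ∘ m x) ->
  (forall x : C, is_iso (fhom H (m x))) ->
  inhabited (nat_iso (comp_functor H F) (comp_functor H G)).
Proof.
intros nat iso; constructor.
refine (@NatIso C E (comp_functor H F) (comp_functor H G)
          (fun x => fhom H (m x)) _ iso).
intros x y f; cbn; now rewrite <- !fhom_comp, nat.
Qed.

(** * The category of isomorphisms, and uniqueness of functors out of a localization *)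

Record iso_arrow (D : category) := IsoArrow {
  iso_src : D;
  iso_tgt : D;
  iso_map : hom iso_src iso_tgt;
  iso_map_is_iso : is_iso iso_map
}.

Definition iso_square (D : category) (f g : iso_arrow D) : Type :=
  {p : hom (iso_src f) (iso_src g) * hom (iso_tgt f) (iso_tgt g) |
    iso_map g ∘ fst p = snd p ∘ iso_map f}.

Lemma iso_square_eq (D : category) (f g : iso_arrow D) (s t : iso_square f g) :
  fst (proj1_sig s) = fst (proj1_sig t) -> snd (proj1_sig s) = snd (proj1_sig t) ->
  s = t.
Proof.
destruct s as [[a b] s], t as [[a' b'] t]; cbn; intros <- <-.
f_equal; apply proof_irrelevance.
Qed.

Program Definition iso_category (D : category) : category :=
  @Category (iso_arrow D) (@iso_square D)
    (fun f => exist _ (idc _, idc _) _)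
    (fun f g h t s => exist _ (fst (proj1_sig t) ∘ fst (proj1_sig s),
                               snd (proj1_sig t) ∘ snd (proj1_sig s)) _) _ _ _.
Next Obligation. now intros; cbn; rewrite comp_idl, comp_idr. Qed.
Next Obligation.
intros D f g h [[a b] t] [[a' b'] s]; cbn in *.
now rewrite comp_assoc, t, <- comp_assoc, s, comp_assoc.
Qed.
Next Obligation. intros; apply iso_square_eq; apply comp_idl. Qed.
Next Obligation. intros; apply iso_square_eq; apply comp_idr. Qed.
Next Obligation. intros; apply iso_square_eq; apply comp_assoc. Qed.

Definition iso_source (D : category) : functor (iso_category D) D :=
  @Functor (iso_category D) D (@iso_src D) (fun _ _ s => fst (proj1_sig s))
    (fun _ => eq_refl) (fun _ _ _ _ _ => eq_refl).

Definition iso_target (D : category) : functor (iso_category D) D :=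
  @Functor (iso_category D) D (@iso_tgt D) (fun _ _ s => snd (proj1_sig s))
    (fun _ => eq_refl) (fun _ _ _ _ _ => eq_refl).

(** The inverses of the two sides again form a commuting square. So a functor into [iso_category]
    inverts an arrow once its source and target functors do. *)
Lemma iso_category_is_iso (D : category) (f g : iso_category D) (s : hom f g) :
  is_iso (fhom (iso_source D) s) -> is_iso (fhom (iso_target D) s) -> is_iso s.
Proof.
destruct s as [[a b] s]; cbn in *; intros [a' [Ha1 Ha2]] [b' [Hb1 Hb2]].
assert (sq : iso_map f ∘ a' = b' ∘ iso_map g).
{ rewrite <- (comp_idl (iso_map f ∘ a')), <- Hb1, comp_assoc, <- (comp_assoc b').
  now rewrite <- s, comp_assoc, <- comp_assoc, Ha2, comp_idr. }
exists (exist _ (a', b') sq); split; apply iso_square_eq; auto.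
Qed.

Lemma iso_category_nat_iso (C D : category) (H : functor C (iso_category D)) :
  nat_iso (comp_functor (iso_source D) H) (comp_functor (iso_target D) H).
Proof.
refine (@NatIso C D (comp_functor (iso_source D) H)
          (comp_functor (iso_target D) H) (fun x => iso_map (H x)) _ _).
- intros x y f; exact (proj2_sig (fhom H f)).
- intros x; apply iso_map_is_iso.
Qed.

Program Definition iso_functor (C D : category) (F G : functor C D)
    (n : nat_iso F G) : functor C (iso_category D) :=
  @Functor C (iso_category D) (fun x => IsoArrow (nat_is_iso n x))
    (fun x y f => exist _ (fhom F f, fhom G f) (nat_naturality n f)) _ _.
Next Obligation. intros; apply iso_square_eq; apply fhom_id. Qed.
Next Obligation. intros; apply iso_square_eq; apply fhom_comp. Qed.

Lemma functor_comp_assoc (B C D E : category) (H : functor D E) (G : functor C D)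
    (F : functor B C) :
  comp_functor H (comp_functor G F) = comp_functor (comp_functor H G) F.
Proof. now apply functor_eq_hom. Qed.

Lemma functor_comp_idl (C D : category) (F : functor C D) :
  comp_functor (id_functor D) F = F.
Proof. destruct F; now apply functor_eq_hom. Qed.

Lemma functor_comp_idr (C D : category) (F : functor C D) :
  comp_functor F (id_functor C) = F.
Proof. destruct F; now apply functor_eq_hom. Qed.

(** Functors preserve isomorphisms, so the common composite inverts [W]; both [A] and [B] are then
    its unique factorization. *)
Lemma localization_functor_eq (K D : category) (W : arrow_class K)
    (L : localization W) (A B : functor L D) :
  comp_functor A (loc_functor L) = comp_functor B (loc_functor L) -> A = B.
Proof.
intros H.
destruct (@loc_universal K W L D (comp_functor B (loc_functor L)))
  as [G [HG HU]].
- intros x y f Wf; exact (is_iso_fhom B (loc_inverts L Wf)).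
- now rewrite <- (HU A H), <- (HU B eq_refl).
Qed.

(* The strict universal property only compares functors by equality; a natural
   isomorphism is handled as a single functor into [iso_category]. *)
Lemma localization_nat_iso (K D : category) (W : arrow_class K)
    (L : localization W) (A B : functor L D) :
  inhabited (nat_iso (comp_functor A (loc_functor L))
                     (comp_functor B (loc_functor L))) ->
  inhabited (nat_iso A B).
Proof.
intros [n].
destruct (@loc_universal K W L (iso_category D) (iso_functor n)) as [H [HH _]].
{ intros x y f Wf; apply iso_category_is_iso.
  - exact (is_iso_fhom A (loc_inverts L Wf)).
  - exact (is_iso_fhom B (loc_inverts L Wf)). }
assert (HA : comp_functor (iso_source D) H = A).
{ apply localization_functor_eq; rewrite <- functor_comp_assoc, HH.
  now apply functor_eq_hom. }
assert (HB : comp_functor (iso_target D) H = B).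
{ apply localization_functor_eq; rewrite <- functor_comp_assoc, HH.
  now apply functor_eq_hom. }
rewrite <- HA, <- HB; constructor; apply iso_category_nat_iso.
Qed.

(** * Functors out of a quotient category *)

Section QuotientFunctor.
Variables (C : category) (R : hom_relation C) (E : is_congruence R).

Program Definition quotient_functor : functor C (quotient_category E) :=
  @Functor C (quotient_category E) (fun x => x) (fun x y f => qclass (@R x y) f) _ _.
Next Obligation. reflexivity. Qed.
Next Obligation. intros; symmetry; apply (qcomp_qclass E). Qed.

Lemma quotient_functor_full (x y : C) (q : @hom (quotient_category E) x y) :
  exists f : hom x y, q = fhom quotient_functor f.
Proof. exists (qrepr q); symmetry; apply qclass_qrepr. Qed.

Lemma quotient_functor_eq (x y : C) (f g : hom x y) :
  R f g -> fhom quotient_functor f = fhom quotient_functor g.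
Proof. apply (qclass_eq (cong_equiv E x y)). Qed.

(** The quotient functor is the identity on objects and full, so the same components work and
    naturality is tested on representatives. *)
Lemma quotient_nat_iso (D : category) (A B : functor (quotient_category E) D) :
  inhabited (nat_iso (comp_functor A quotient_functor)
                     (comp_functor B quotient_functor)) ->
  inhabited (nat_iso A B).
Proof.
intros [[m nat iso]]; constructor.
refine (@NatIso _ _ A B m _ iso).
intros x y q; destruct (quotient_functor_full q) as [f ->]; apply nat.
Qed.

Lemma quotient_lift (D : category) (F : functor C D) :
  (forall (x y : C) (f g : hom x y), R f g -> fhom F f = fhom F g) ->
  exists G : functor (quotient_category E) D, comp_functor G quotient_functor = F.
Proof.
intros HF.
(* The chosen representative may differ from [f], but [F] does not see the difference. *)
assert (Hr : forall (x y : C) (f : hom x y), fhom F (qrepr (qclass (@R x y) f)) = fhom F f).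
{ intros x y f; apply HF, qrepr_qclass, (cong_equiv E). }
unshelve eexists (@Functor (quotient_category E) D (fun x => F x)
                    (fun x y q => fhom F (qrepr q)) _ _).
- intros x; cbn; rewrite Hr; apply fhom_id.
- intros x y z g f; cbn; unfold qcomp; rewrite Hr; apply fhom_comp.
- destruct F; now apply functor_eq_hom.
Qed.

End QuotientFunctor.

(** * Cofibrant and fibrant replacement functors from a functorial factorization *)

Section Factorization.
Variables (K : category) (FF : functorial_factorization K).

Lemma fact_map_eq (x y x' y' : K) (f : hom x y) (f' : hom x' y')
    (u u' : hom x x') (v v' : hom y y') (s : f' ∘ u = v ∘ f) (s' : f' ∘ u' = v' ∘ f) :
  u = u' -> v = v' -> fact_map FF s = fact_map FF s'.
Proof. intros <- <-; f_equal; apply proof_irrelevance. Qed.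

Section LeftReplacement.
Variable S : finite_coproducts K.

Lemma of_initial_square (x y : K) (f : hom x y) :
  of_initial S y ∘ idc _ = f ∘ of_initial S x.
Proof. now rewrite comp_idr, (of_initial_unique (f ∘ _)). Qed.

Program Definition left_replacement : functor K K :=
  @Functor K K (fun x => fact_ob FF (of_initial S x))
    (fun x y f => fact_map FF (of_initial_square f)) _ _.
Next Obligation. intros; apply fact_map_id. Qed.
Next Obligation.
intros x y z g f; cbn.
(* [fact_map_comp] produces a square with top [idc _ ∘ idc _], while the functor uses top [idc _];
   [fact_map_eq] identifies the two induced maps. *)
assert (sq : of_initial S z ∘ (idc _ ∘ idc _) = g ∘ f ∘ of_initial S x).
{ now rewrite comp_idl, (of_initial_square (g ∘ f)). }
rewrite <- (fact_map_comp FF (of_initial_square f) (of_initial_square g) sq).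
apply fact_map_eq; auto; now rewrite comp_idl.
Qed.

End LeftReplacement.

Section RightReplacement.
Variable P : finite_products K.

Lemma to_terminal_square (x y : K) (f : hom x y) :
  to_terminal P y ∘ f = idc _ ∘ to_terminal P x.
Proof. now rewrite comp_idl, (to_terminal_unique (_ ∘ f)). Qed.

Program Definition right_replacement : functor K K :=
  @Functor K K (fun x => fact_ob FF (to_terminal P x))
    (fun x y f => fact_map FF (to_terminal_square f)) _ _.
Next Obligation. intros; apply fact_map_id. Qed.
Next Obligation.
intros x y z g f; cbn.
assert (sq : to_terminal P z ∘ (g ∘ f) = (idc _ ∘ idc _) ∘ to_terminal P x).
{ now rewrite comp_idl, (to_terminal_square (g ∘ f)). }
rewrite <- (fact_map_comp FF (to_terminal_square f) (to_terminal_square g) sq).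
apply fact_map_eq; auto; now rewrite comp_idl.
Qed.

End RightReplacement.
End Factorization.

(** * Composition with pairings and copairings *)

Section Products.
Variables (K : category) (P : finite_products K).

Lemma pair_comp (t z x y : K) (f : hom z x) (g : hom z y) (h : hom t z) :
  pair P f g ∘ h = pair P (f ∘ h) (g ∘ h).
Proof. rewrite (pair_unique (pair P f g ∘ h)), !comp_assoc, pr1_pair, pr2_pair; auto. Qed.

End Products.

Section Coproducts.
Variables (K : category) (S : finite_coproducts K).

Lemma copair_comp (x y z t : K) (f : hom x z) (g : hom y z) (h : hom z t) :
  h ∘ copair S f g = copair S (h ∘ f) (h ∘ g).
Proof.
rewrite (copair_unique (h ∘ copair S f g)), <- !comp_assoc, copair_in1, copair_in2; auto.
Qed.

End Coproducts.

Section Model.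
Variables (K : category) (P : finite_products K) (S : finite_coproducts K)
  (M : model_structure K).

Local Notation cof := (cof M).
Local Notation fib := (fib M).
Local Notation weq := (weq M).
Local Notation cofibrant := (cofibrant S M).
Local Notation fibrant := (fibrant P M).

(** * Weak factorization systems *)

Lemma weq_id (x : K) : weq (idc x).
Proof. apply (weq_subcategory M). Qed.

Lemma weq_comp (x y z : K) (g : hom y z) (f : hom x y) :
  weq g -> weq f -> weq (g ∘ f).
Proof. apply (weq_subcategory M). Qed.

Lemma cof_comp (x y z : K) (g : hom y z) (f : hom x y) :
  cof g -> cof f -> cof (g ∘ f).
Proof. apply (cof_subcategory M). Qed.

Lemma fib_comp (x y z : K) (g : hom y z) (f : hom x y) :
  fib g -> fib f -> fib (g ∘ f).
Proof. apply (fib_subcategory M). Qed.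

Lemma weq_cancel_left (x y z : K) (g : hom y z) (f : hom x y) :
  weq g -> weq (g ∘ f) -> weq f.
Proof. apply (weq_two_out_of_three M f g). Qed.

Lemma weq_cancel_right (x y z : K) (g : hom y z) (f : hom x y) :
  weq f -> weq (g ∘ f) -> weq g.
Proof. apply (weq_two_out_of_three M f g). Qed.

Lemma factor_cof_tfib (x y : K) (f : hom x y) :
  exists (z : K) (i : hom x z) (p : hom z y), cof i /\ fib p /\ weq p /\ p ∘ i = f.
Proof.
exists _, (fact_left (fact_cof_tfib M) f), (fact_right (fact_cof_tfib M) f).
destruct (fact_cof_tfib_spec M f) as [? [? ?]]; auto using fact_eq.
Qed.

Lemma factor_tcof_fib (x y : K) (f : hom x y) :
  exists (z : K) (i : hom x z) (p : hom z y), cof i /\ weq i /\ fib p /\ p ∘ i = f.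
Proof.
exists _, (fact_left (fact_tcof_fib M) f), (fact_right (fact_tcof_fib M) f).
destruct (fact_tcof_fib_spec M f) as [? [? ?]]; auto using fact_eq.
Qed.

(** Retract argument: factoring [f] as [p ∘ i] and lifting [f] against [p] exhibits [f] as a retract
    of the cofibration [i]. *)
Lemma llp_cof (x y : K) (f : hom x y) :
  (forall (a b : K) (g : hom a b), fib g -> weq g -> has_llp f g) -> cof f.
Proof.
intros H; destruct (factor_cof_tfib f) as [z [i [p [ci [fp [wp E]]]]]].
destruct (H z y p fp wp i (idc y)) as [h [Hh1 Hh2]]; [now rewrite comp_idl |].
apply (@cof_retract K M x y x z f i); auto.
exists (idc x), (idc x), h, p; now rewrite comp_idl, !comp_idr.
Qed.

Lemma rlp_fib (a b : K) (g : hom a b) :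
  (forall (x y : K) (f : hom x y), cof f -> weq f -> has_llp f g) -> fib g.
Proof.
intros H; destruct (factor_tcof_fib g) as [z [i [p [ci [wi [fp E]]]]]].
destruct (H a z i ci wi (idc a) p) as [h [Hh1 Hh2]]; [now rewrite comp_idr |].
apply (@fib_retract K M a b z b g p); auto.
exists i, h, (idc b), (idc b); now rewrite !comp_idl.
Qed.

(** Without appeal to pushouts, a lift is built summand by summand: it is [u] on [x], and cofibrancy
    of [y] supplies it on [y]. *)
Lemma cof_in1 (x y : K) : cofibrant y -> cof (in1 S x y).
Proof.
intros Hy; apply llp_cof; intros a b g fg wg u v E.
destruct (cof_tfib_lift Hy fg wg (u := of_initial S a) (v := v ∘ in2 S x y))
  as [h [_ Hh]].
{ now rewrite (of_initial_unique (g ∘ _)), (of_initial_unique (_ ∘ _)). }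
exists (copair S u h); split; [apply copair_in1 |].
now rewrite copair_comp, E, Hh, <- copair_unique.
Qed.

Lemma cof_in2 (x y : K) : cofibrant x -> cof (in2 S x y).
Proof.
intros Hx; apply llp_cof; intros a b g fg wg u v E.
destruct (cof_tfib_lift Hx fg wg (u := of_initial S a) (v := v ∘ in1 S x y))
  as [h [_ Hh]].
{ now rewrite (of_initial_unique (g ∘ _)), (of_initial_unique (_ ∘ _)). }
exists (copair S h u); split; [apply copair_in2 |].
now rewrite copair_comp, E, Hh, <- copair_unique.
Qed.

(** Dually, fibrancy of [x] extends the first coordinate along [f], and the second coordinate is
    [v]. *)
Lemma fib_pr2 (x y : K) : fibrant x -> fib (pr2 P x y).
Proof.
intros Hx; apply rlp_fib; intros a b f cf wf u v E.
destruct (tcof_fib_lift cf wf Hx (u := pr1 P x y ∘ u) (v := to_terminal P b))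
  as [h [Hh _]].
{ now rewrite (to_terminal_unique (_ ∘ f)), (to_terminal_unique (_ ∘ _)). }
exists (pair P h v); split; [| apply pr2_pair].
now rewrite pair_comp, Hh, <- E, <- pair_unique.
Qed.

Lemma cofibrant_cof (x y : K) (f : hom x y) : cofibrant x -> cof f -> cofibrant y.
Proof.
intros Hx Hf; unfold Defs.cofibrant.
rewrite <- (of_initial_unique (f ∘ of_initial S x)); now apply cof_comp.
Qed.

Lemma fibrant_fib (x y : K) (f : hom x y) : fibrant y -> fib f -> fibrant x.
Proof.
intros Hy Hf; unfold Defs.fibrant.
rewrite <- (to_terminal_unique (to_terminal P y ∘ f)); now apply fib_comp.
Qed.

(** * The homotopy relation *)

Section Cylinder.
Variables (x c : K) (mu : hom (coprod S x x) c) (sigma : hom c x).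
Hypotheses (Hx : cofibrant x) (cmu : cof mu) (wsigma : weq sigma)
  (E : sigma ∘ mu = copair S (idc x) (idc x)).

Lemma cylinder_in1 : sigma ∘ (mu ∘ in1 S x x) = idc x.
Proof. now rewrite comp_assoc, E, copair_in1. Qed.

Lemma cylinder_in2 : sigma ∘ (mu ∘ in2 S x x) = idc x.
Proof. now rewrite comp_assoc, E, copair_in2. Qed.

(** The end is a section of the weak equivalence [sigma], so two-out-of-three applies. *)
Lemma cylinder_tcof1 : cof (mu ∘ in1 S x x) /\ weq (mu ∘ in1 S x x).
Proof.
split; [now apply cof_comp, cof_in1 |].
apply (weq_cancel_left wsigma); rewrite cylinder_in1; apply weq_id.
Qed.

Lemma cylinder_tcof2 : cof (mu ∘ in2 S x x) /\ weq (mu ∘ in2 S x x).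
Proof.
split; [now apply cof_comp, cof_in2 |].
apply (weq_cancel_left wsigma); rewrite cylinder_in2; apply weq_id.
Qed.

End Cylinder.

Lemma left_homotopic_refl (x y : K) (f : hom x y) : left_homotopic S M f f.
Proof.
destruct (factor_cof_tfib (copair S (idc x) (idc x)))
  as [c [mu [sigma [cmu [_ [ws E]]]]]].
exists c, mu, sigma, (f ∘ sigma); repeat split; auto.
now rewrite <- comp_assoc, E, copair_comp, comp_idr.
Qed.

Lemma right_homotopic_refl (x y : K) (f : hom x y) : right_homotopic P M f f.
Proof.
destruct (factor_tcof_fib (pair P (idc y) (idc y)))
  as [p [kappa [varpi [_ [wk [fv E]]]]]].
exists p, varpi, kappa, (kappa ∘ f); repeat split; auto.
now rewrite comp_assoc, E, pair_comp, comp_idl.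
Qed.

Lemma left_homotopic_post (x y z : K) (g : hom y z) (f f' : hom x y) :
  left_homotopic S M f f' -> left_homotopic S M (g ∘ f) (g ∘ f').
Proof.
intros [c [mu [sigma [om [cm [ws [E1 E2]]]]]]].
exists c, mu, sigma, (g ∘ om); repeat split; auto.
now rewrite <- comp_assoc, E2, copair_comp.
Qed.

Lemma right_homotopic_pre (x y z : K) (g g' : hom y z) (f : hom x y) :
  right_homotopic P M g g' -> right_homotopic P M (g ∘ f) (g' ∘ f).
Proof.
intros [p [varpi [kappa [psi [fv [wk [E1 E2]]]]]]].
exists p, varpi, kappa, (psi ∘ f); repeat split; auto.
now rewrite comp_assoc, E2, pair_comp.
Qed.

Lemma left_right_trans (x y : K) (f g h : hom x y) : cofibrant x ->
  left_homotopic S M f g -> right_homotopic P M g h -> right_homotopic P M f h.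
Proof.
intros Hx [c [mu [sigma [om [cm [ws [E1 E2]]]]]]]
  [p [varpi [kappa [psi [fv [wk [E3 E4]]]]]]].
destruct (cylinder_tcof2 Hx cm ws E1) as [ci wi].
(* Over the cylinder, the first coordinate moves from [f] to [g] and the second stays at [h]. At the
   second end this is [(g, h)], which [psi] covers. *)
destruct (tcof_fib_lift ci wi fv (u := psi) (v := pair P om (h ∘ sigma)))
  as [H [_ HH]].
{ rewrite E4, pair_comp, <- (comp_assoc h), (cylinder_in2 E1), comp_idr.
  now rewrite comp_assoc, E2, copair_in2. }
exists p, varpi, kappa, (H ∘ (mu ∘ in1 S x x)); repeat split; auto.
rewrite comp_assoc, HH, pair_comp, <- (comp_assoc h), (cylinder_in1 E1), comp_idr.
now rewrite comp_assoc, E2, copair_in1.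
Qed.

(** The same lifting, started at the first end of the cylinder; taking [h] to be [f] reverses a
    homotopy. *)
Lemma left_right_euclid (x y : K) (f g h : hom x y) : cofibrant x ->
  left_homotopic S M f g -> right_homotopic P M f h -> right_homotopic P M g h.
Proof.
intros Hx [c [mu [sigma [om [cm [ws [E1 E2]]]]]]]
  [p [varpi [kappa [psi [fv [wk [E3 E4]]]]]]].
destruct (cylinder_tcof1 Hx cm ws E1) as [ci wi].
destruct (tcof_fib_lift ci wi fv (u := psi) (v := pair P om (h ∘ sigma)))
  as [H [_ HH]].
{ rewrite E4, pair_comp, <- (comp_assoc h), (cylinder_in1 E1), comp_idr.
  now rewrite comp_assoc, E2, copair_in1. }
exists p, varpi, kappa, (H ∘ (mu ∘ in2 S x x)); repeat split; auto.
rewrite comp_assoc, HH, pair_comp, <- (comp_assoc h), (cylinder_in2 E1), comp_idr.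
now rewrite comp_assoc, E2, copair_in2.
Qed.

Lemma right_left_trans (x y : K) (f g h : hom x y) : fibrant y ->
  right_homotopic P M f g -> left_homotopic S M g h -> left_homotopic S M f h.
Proof.
intros Hy [p [varpi [kappa [psi [fv [wk [E3 E4]]]]]]]
  [c [mu [sigma [om [cm [ws [E1 E2]]]]]]].
assert (F1 : pr1 P y y ∘ varpi ∘ kappa = idc y).
{ now rewrite <- comp_assoc, E3, pr1_pair. }
assert (F2 : pr2 P y y ∘ varpi ∘ kappa = idc y).
{ now rewrite <- comp_assoc, E3, pr2_pair. }
assert (fp : fib (pr2 P y y ∘ varpi)) by now apply fib_comp, fv; apply fib_pr2.
assert (wp : weq (pr2 P y y ∘ varpi)).
{ apply (weq_cancel_right wk); rewrite F2; apply weq_id. }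
(* The lift [H] has second coordinate [om], from [g] to [h], and ends at [psi] and at the constant
   path on [h]. Its first coordinate therefore runs from [f] to [h]. *)
destruct (cof_tfib_lift cm fp wp (u := copair S psi (kappa ∘ h)) (v := om))
  as [H [HH _]].
{ rewrite E2, copair_comp, (comp_assoc _ kappa), F2, comp_idl.
  now rewrite <- comp_assoc, E4, pr2_pair. }
exists c, mu, sigma, (pr1 P y y ∘ varpi ∘ H); repeat split; auto.
rewrite <- comp_assoc, HH, copair_comp, (comp_assoc _ kappa), F1, comp_idl.
now rewrite <- comp_assoc, E4, pr1_pair.
Qed.

(** Compose with the constant right homotopy at [g]. *)
Lemma left_homotopic_right (x y : K) (f g : hom x y) : cofibrant x ->
  left_homotopic S M f g -> right_homotopic P M f g.
Proof. eauto using left_right_trans, right_homotopic_refl. Qed.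

Lemma right_homotopic_left (x y : K) (f g : hom x y) : fibrant y ->
  right_homotopic P M f g -> left_homotopic S M f g.
Proof. eauto using right_left_trans, left_homotopic_refl. Qed.

(** Symmetry and transitivity pass through right homotopy, where the mixed compositions land, and
    then return. *)
Lemma left_homotopic_equiv (x y : K) : cofibrant x -> fibrant y ->
  Equivalence (@left_homotopic K S M x y).
Proof.
intros Hx Hy; split.
- intros f; apply left_homotopic_refl.
- intros f g Hfg; apply right_homotopic_left; auto.
  apply (left_right_euclid Hx Hfg), right_homotopic_refl.
- intros f g h Hfg Hgh; apply right_homotopic_left; auto.
  apply (left_right_trans Hx Hfg); now apply left_homotopic_right.
Qed.

Lemma cf_homotopic_congruence : is_congruence (cf_homotopic P S M).
Proof.
split.
- intros [x [cx fx]] [y [cy fy]]; now apply left_homotopic_equiv.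
- intros x y z g f f'; apply left_homotopic_post.
- intros [x [cx fx]] [y [cy fy]] [z [cz fz]] g g' f H.
  (* Precomposition acts directly on maps into a path object, hence the detour through right
     homotopy. *)
  now apply right_homotopic_left, right_homotopic_pre, left_homotopic_right.
Qed.

(** * Weak equivalences are homotopy equivalences *)

Local Notation Kcf := (cf_subcategory P S M).
Local Notation Ho := (quotient_category cf_homotopic_congruence).
Local Notation quo := (quotient_functor cf_homotopic_congruence).

Lemma homotopy_equivalence_iso (x y : Kcf) (f : hom x y) (g : hom y x) :
  cf_homotopic P S M (g ∘ f) (idc x) -> cf_homotopic P S M (f ∘ g) (idc y) ->
  is_iso (fhom quo f).
Proof.
intros H1 H2; exists (fhom quo g); split; rewrite <- fhom_comp, <- fhom_id;
  now apply quotient_functor_eq.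
Qed.

(** Cofibrancy of [y] gives a section [s]. Since [s ∘ f] and the identity agree after [f], the
    constant homotopy [f ∘ sigma] lifts along [f] to one between them. *)
Lemma tfib_iso (x y : Kcf) (f : hom x y) :
  @Defs.fib K M (proj1_sig x) (proj1_sig y) f ->
  @Defs.weq K M (proj1_sig x) (proj1_sig y) f -> is_iso (fhom quo f).
Proof.
destruct x as [x [cx fx]], y as [y [cy fy]]; cbn in f |- *; intros ff wf.
destruct (cof_tfib_lift cy ff wf (u := of_initial S x) (v := idc y)) as [s [_ Hs]].
{ now rewrite (of_initial_unique (f ∘ _)), (of_initial_unique (_ ∘ _)). }
apply (@homotopy_equivalence_iso (exist _ x (conj cx fx)) (exist _ y (conj cy fy)) f s).
- destruct (factor_cof_tfib (copair S (idc x) (idc x)))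
    as [c [mu [sigma [cmu [_ [ws E]]]]]].
  destruct (cof_tfib_lift cmu ff wf (u := copair S (s ∘ f) (idc x)) (v := f ∘ sigma))
    as [om [Ho _]].
  { now rewrite <- comp_assoc, E, !copair_comp, comp_assoc, Hs, comp_idl, comp_idr. }
  exists c, mu, sigma, om; auto.
- unfold cf_homotopic; cbn; rewrite Hs; apply left_homotopic_refl.
Qed.

(** Dually, fibrancy of [x] gives a retraction [r], and the constant path [kappa ∘ f] extends along
    [f] to a right homotopy from [f ∘ r] to the identity. *)
Lemma tcof_iso (x y : Kcf) (f : hom x y) :
  @Defs.cof K M (proj1_sig x) (proj1_sig y) f ->
  @Defs.weq K M (proj1_sig x) (proj1_sig y) f -> is_iso (fhom quo f).
Proof.
destruct x as [x [cx fx]], y as [y [cy fy]]; cbn in f |- *; intros cf wf.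
destruct (tcof_fib_lift cf wf fx (u := idc x) (v := to_terminal P y)) as [r [Hr _]].
{ now rewrite (to_terminal_unique (_ ∘ f)), (to_terminal_unique (_ ∘ _)). }
apply (@homotopy_equivalence_iso (exist _ x (conj cx fx)) (exist _ y (conj cy fy)) f r).
- unfold cf_homotopic; cbn; rewrite Hr; apply left_homotopic_refl.
- apply right_homotopic_left; auto.
  destruct (factor_tcof_fib (pair P (idc y) (idc y)))
    as [p [kappa [varpi [_ [wk [fv E]]]]]].
  destruct (tcof_fib_lift cf wf fv (u := kappa ∘ f) (v := pair P (f ∘ r) (idc y)))
    as [psi [_ Hp]].
  { now rewrite comp_assoc, E, !pair_comp, <- comp_assoc, Hr, comp_idl, comp_idr. }
  exists p, varpi, kappa, psi; auto.
Qed.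

Lemma cf_weq_iso (x y : Kcf) (f : hom x y) :
  @Defs.weq K M (proj1_sig x) (proj1_sig y) f -> is_iso (fhom quo f).
Proof.
intros wf.
destruct (@factor_tcof_fib (proj1_sig x) (proj1_sig y) f)
  as [z [i [p [ci [wi [fp E]]]]]].
(* The middle object inherits cofibrancy from [x] and fibrancy from [y], so both factors live in
   [Kcf]. *)
assert (Hz : cofibrant z /\ fibrant z).
{ split; [apply (cofibrant_cof (proj1 (proj2_sig x)) ci)
         | apply (fibrant_fib (proj2 (proj2_sig y)) fp)]. }
pose (z' := exist _ z Hz : Kcf).
assert (wp : weq p) by (apply (weq_cancel_right wi); now rewrite E).
assert (E' : f = @comp Kcf x z' y p i) by (cbn; auto).
rewrite E', fhom_comp.
apply is_iso_comp; [now apply (@tfib_iso z' y) | now apply (@tcof_iso x z')].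
Qed.

(** * Cofibrant-fibrant replacement *)

Local Notation Q := (left_replacement (fact_cof_tfib M) S).
Local Notation R := (right_replacement (fact_tcof_fib M) P).

Definition left_counit (x : K) : hom (Q x) x := fact_right (fact_cof_tfib M) (of_initial S x).

Definition right_unit (x : K) : hom x (R x) := fact_left (fact_tcof_fib M) (to_terminal P x).

Lemma left_counit_natural (x y : K) (f : hom x y) :
  left_counit y ∘ fhom Q f = f ∘ left_counit x.
Proof. apply fact_map_right. Qed.

Lemma right_unit_natural (x y : K) (f : hom x y) :
  right_unit y ∘ f = fhom R f ∘ right_unit x.
Proof. apply fact_map_left. Qed.

Lemma left_counit_tfib (x : K) : fib (left_counit x) /\ weq (left_counit x).
Proof. apply fact_cof_tfib_spec. Qed.

Lemma right_unit_tcof (x : K) : cof (right_unit x) /\ weq (right_unit x).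
Proof. destruct (fact_tcof_fib_spec M (to_terminal P x)) as [? [? ?]]; now split. Qed.

Lemma left_replacement_cofibrant (x : K) : cofibrant (Q x).
Proof.
unfold Defs.cofibrant.
rewrite <- (of_initial_unique (x := Q x) (fact_left (fact_cof_tfib M) (of_initial S x))).
apply fact_cof_tfib_spec.
Qed.

(** This keeps the middle of the zigzag [x <- Qx -> RQx] inside [Kcf] when [x] is there. *)
Lemma left_replacement_cf (x : K) : fibrant x -> cofibrant (Q x) /\ fibrant (Q x).
Proof.
split; [apply left_replacement_cofibrant |].
exact (fibrant_fib H (proj1 (left_counit_tfib x))).
Qed.

Lemma replacement_cf (x : K) : cofibrant (R (Q x)) /\ fibrant (R (Q x)).
Proof.
split.
- exact (cofibrant_cof (left_replacement_cofibrant x) (proj1 (right_unit_tcof (Q x)))).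
- unfold Defs.fibrant.
  rewrite <- (to_terminal_unique (x := R (Q x))
                (fact_right (fact_tcof_fib M) (to_terminal P (Q x)))).
  apply fact_tcof_fib_spec.
Qed.

Program Definition cf_replacement : functor K Kcf :=
  @Functor K Kcf (fun x => exist _ (R (Q x)) (replacement_cf x))
    (fun x y f => fhom R (fhom Q f)) _ _.
Next Obligation. intros; apply (fhom_id (comp_functor R Q)). Qed.
Next Obligation. intros; apply (fhom_comp (comp_functor R Q)). Qed.

(** Two-out-of-three in the naturality square of [left_counit]. *)
Lemma left_replacement_weq (x y : K) (f : hom x y) : weq f -> weq (fhom Q f).
Proof.
intros wf; apply (weq_cancel_left (proj2 (left_counit_tfib y))).
rewrite left_counit_natural; apply weq_comp, left_counit_tfib; auto.
Qed.

Lemma right_replacement_weq (x y : K) (f : hom x y) : weq f -> weq (fhom R f).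
Proof.
intros wf; apply (weq_cancel_right (proj2 (right_unit_tcof x))).
rewrite <- right_unit_natural; apply weq_comp; auto; apply right_unit_tcof.
Qed.

Lemma cf_replacement_inverts : inverts (Defs.weq M) (comp_functor quo cf_replacement).
Proof.
intros x y f wf; apply cf_weq_iso.
now apply right_replacement_weq, left_replacement_weq.
Qed.

Definition cf_inclusion : functor Kcf K :=
  @Functor Kcf K (@proj1_sig _ _) (fun _ _ f => f)
    (fun _ => eq_refl) (fun _ _ _ _ _ => eq_refl).

Program Definition left_replacement_on_cf : functor Kcf Kcf :=
  @Functor Kcf Kcf
    (fun x => exist _ (Q (proj1_sig x)) (left_replacement_cf (proj2 (proj2_sig x))))
    (fun x y f => fhom Q (x := proj1_sig x) (y := proj1_sig y) f) _ _.
Next Obligation. intros; apply (fhom_id Q). Qed.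
Next Obligation. intros; apply (fhom_comp Q). Qed.

(** Both legs of the zigzag are weak equivalences of [Kcf], hence isomorphisms in the quotient; the
    leg given by [right_unit] is inverted. *)
Lemma cf_replacement_quotient :
  inhabited (nat_iso (comp_functor (comp_functor quo cf_replacement) cf_inclusion) quo).
Proof.
rewrite <- functor_comp_assoc.
apply nat_iso_trans with (comp_functor quo left_replacement_on_cf).
- apply nat_iso_sym.
  apply (@nat_iso_whisker _ _ _ quo left_replacement_on_cf
           (comp_functor cf_replacement cf_inclusion)
           (fun x => right_unit (Q (proj1_sig x)))).
  + intros x y f; exact (right_unit_natural (fhom Q f)).
  + intros x; apply cf_weq_iso, right_unit_tcof.
- rewrite <- (functor_comp_idr quo) at 2.
  apply (@nat_iso_whisker _ _ _ quo left_replacement_on_cf (id_functor Kcf)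
           (fun x => left_counit (proj1_sig x))).
  + intros x y f; exact (left_counit_natural f).
  + intros x; apply cf_weq_iso, left_counit_tfib.
Qed.

(** For general [x] the zigzag leaves [Kcf], but [F] inverts all weak equivalences of [K]. *)
Lemma cf_replacement_inverting (D : category) (F : functor K D) :
  inverts (Defs.weq M) F ->
  inhabited (nat_iso (comp_functor (comp_functor F cf_inclusion) cf_replacement) F).
Proof.
intros FW; rewrite <- functor_comp_assoc.
apply nat_iso_trans with (comp_functor F Q).
- apply nat_iso_sym.
  apply (@nat_iso_whisker _ _ _ F Q (comp_functor cf_inclusion cf_replacement)
           (fun x => right_unit (Q x))).
  + intros x y f; exact (right_unit_natural (fhom Q f)).
  + intros x; apply FW, right_unit_tcof.
- rewrite <- (functor_comp_idr F) at 2.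
  apply (@nat_iso_whisker _ _ _ F Q (id_functor K) left_counit).
  + intros x y f; exact (left_counit_natural f).
  + intros x; apply FW, left_counit_tfib.
Qed.

(* Both ends of a cylinder are sections of one weak equivalence. *)
Lemma inverts_left_homotopic (D : category) (F : functor K D) (x y : K)
    (f g : hom x y) :
  inverts (Defs.weq M) F -> left_homotopic S M f g -> fhom F f = fhom F g.
Proof.
intros FW [c [mu [sigma [om [cm [ws [E1 E2]]]]]]].
assert (H : fhom F (mu ∘ in1 S x x) = fhom F (mu ∘ in2 S x x)).
{ apply (is_iso_mono (FW _ _ _ ws)).
  now rewrite <- !fhom_comp, (cylinder_in1 E1), (cylinder_in2 E1). }
replace f with (om ∘ (mu ∘ in1 S x x)) by now rewrite comp_assoc, E2, copair_in1.
replace g with (om ∘ (mu ∘ in2 S x x)) by now rewrite comp_assoc, E2, copair_in2.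
now rewrite !(fhom_comp F om), H.
Qed.

(** [F] is induced by the inclusion and [G] by the replacement. Each round trip is compared after
    precomposing with the quotient or localization functor, where the strict equations [HF] and [HG]
    reduce it to the replacement zigzag. *)
Lemma quotient_localization_equivalent (L : localization (Defs.weq M)) :
  equivalent_categories Ho L.
Proof.
destruct (@quotient_lift _ _ cf_homotopic_congruence _
            (comp_functor (loc_functor L) cf_inclusion)) as [F HF].
{ intros x y f g; exact (inverts_left_homotopic (loc_inverts L)). }
destruct (loc_universal L cf_replacement_inverts) as [G [HG _]].
exists F, G; split.
- apply quotient_nat_iso.
  rewrite <- functor_comp_assoc, HF, functor_comp_assoc, HG, functor_comp_idl.
  apply cf_replacement_quotient.
- apply localization_nat_iso.
  rewrite <- functor_comp_assoc, HG, functor_comp_assoc, HF, functor_comp_idl.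
  apply cf_replacement_inverting, loc_inverts.
Qed.

End Model.

Theorem theorem4 (K : category) (P : finite_products K) (S : finite_coproducts K)
    (M : model_structure K) :
  (forall (x y : cf_subcategory P S M) (alpha beta : hom x y),
     @left_homotopic K S M (proj1_sig x) (proj1_sig y) alpha beta <->
     @right_homotopic K P M (proj1_sig x) (proj1_sig y) alpha beta) /\
  exists E : is_congruence (cf_homotopic P S M),
    forall L : localization (weq M),
      equivalent_categories (quotient_category E) L.
Proof.
split.
- intros [x [cx fx]] [y [cy fy]] f g; split.
  + now apply left_homotopic_right.
  + now apply right_homotopic_left.
- exists (cf_homotopic_congruence P S M); apply quotient_localization_equivalent.
Qed.
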